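(* Let $\mathcal{A}\in\mathbb{C}^{I_1\times\cdots\times I_N\times I_1\times\cdots\times I_N}$. Then $0\in W(\mathcal{A})$ if and only if $0\in W(\mathcal{A}^\dagger)$.
   Context: For tensors $\mathcal{A},\mathcal{B}\in\mathbb{C}^{I_1\times\cdots\times I_N\times I_1\times\cdots\times I_N}$ the Einstein product is $(\mathcal{A}*_N\mathcal{B})_{i_1\ldots i_Nj_1\ldots j_N}=\sum_{k_1,\ldots,k_N}a_{i_1\ldots i_Nk_1\ldots k_N}b_{k_1\ldots k_Nj_1\ldots j_N}$, and for $\mathcal{X}\in\mathbb{C}^{I_1\times\cdots\times I_N}$, $(\mathcal{A}*_N\mathcal{X})_{i_1\ldots i_N}=\sum_{k_1,\ldots,k_N}a_{i_1\ldots i_Nk_1\ldots k_N}x_{k_1\ldots k_N}$. The conjugate transpose is $(\mathcal{A}^H)_{i_1\ldots i_Nj_1\ldots j_N}=\overline{a_{j_1\ldots j_Ni_1\ldots i_N}}$. The Moore--Penrose inverse $\mathcal{A}^\dagger$ of $\mathcal{A}$ is the unique tensor $\mathcal{X}$ of the same size satisfying $\mathcal{A}*_N\mathcal{X}*_N\mathcal{A}=\mathcal{A}$, $\mathcal{X}*_N\mathcal{A}*_N\mathcal{X}=\mathcal{X}$, $(\mathcal{A}*_N\mathcal{X})^H=\mathcal{A}*_N\mathcal{X}$, $(\mathcal{X}*_N\mathcal{A})^H=\mathcal{X}*_N\mathcal{A}$. With $\langle\mathcal{X},\mathcal{Y}\rangle=\sum_{i_1,\ldots,i_N}x_{i_1\ldots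 i_N}\overline{y_{i_1\ldots i_N}}$ and $\|\mathcal{X}\|=\langle\mathcal{X},\mathcal{X}\rangle^{1/2}$, the numerical range is $W(\mathcal{A})=\{\langle\mathcal{A}*_N\mathcal{X},\mathcal{X}\rangle:\mathcal{X}\in\mathbb{C}^{I_1\times\cdots\times I_N},\|\mathcal{X}\|=1\}$. *)

(* Defs.v *)
From mathcomp Require Import all_boot all_order all_algebra.
From mathcomp Require Import boolp classical_sets reals.
From mathcomp Require Export complex.

Set Implicit Arguments.
Unset Strict Implicit.
Unset Printing Implicit Defensive.

Import GRing.Theory Num.Theory.
Local Open Scope ring_scope.

Definition multi_index (N : nat) (I : 'I_N -> nat) : finType :=
  {dffun forall k : 'I_N, 'I_(I k)}.

(* C^(I_1 x ... x I_N) *)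
Definition tensor (C : Type) (N : nat) (I : 'I_N -> nat) : Type :=
  {ffun multi_index I -> C}.

(* C^(I_1 x ... x I_N x I_1 x ... x I_N): the 2N indices are grouped as
   ((i_1, ..., i_N), (j_1, ..., j_N)). *)
Definition sqtensor (C : Type) (N : nat) (I : 'I_N -> nat) : Type :=
  {ffun multi_index I * multi_index I -> C}.

Section Tensors.
Variables (C : numClosedFieldType) (N : nat) (I : 'I_N -> nat).
Implicit Types (A B : sqtensor C I) (X Y : tensor C I).

Definition einstein A B : sqtensor C I :=
  [ffun ij => \sum_(k : multi_index I) A (ij.1, k) * B (k, ij.2)].

Definition einstein_app A X : tensor C I :=
  [ffun i => \sum_(k : multi_index I) A (i, k) * X k].

Definition conj_tr A : sqtensor C I := [ffun ij => (A (ij.2, ij.1))^*].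

Definition inner X Y : C := \sum_(i : multi_index I) X i * (Y i)^*.

Definition tnorm X : C := sqrtC (inner X X).

Definition numrange A : set C :=
  [set inner (einstein_app A X) X | X in [set X | tnorm X = 1]]%classic.

Definition is_mpinv A B : Prop :=
  [/\ einstein (einstein A B) A = A,
      einstein (einstein B A) B = B,
      conj_tr (einstein A B) = einstein A B &
      conj_tr (einstein B A) = einstein B A].

Let n := #|multi_index I|.

Definition sqtensor_mx A : 'M[C]_n :=
  \matrix_(i, j) A (enum_val i, enum_val j).

Definition mx_sqtensor (M : 'M[C]_n) : sqtensor C I :=
  [ffun ij => M (enum_rank ij.1) (enum_rank ij.2)].

Lemma sqtensor_mxK : cancel sqtensor_mx mx_sqtensor.
Proof. by move=> A; apply/ffunP=> -[i j]; rewrite !ffunE mxE !enum_rankK. Qed.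

Lemma mx_sqtensorK : cancel mx_sqtensor sqtensor_mx.
Proof. by move=> M; apply/matrixP=> i j; rewrite !(mxE, ffunE) !enum_valK. Qed.

Lemma sqtensor_mxM A B :
  sqtensor_mx (einstein A B) = sqtensor_mx A *m sqtensor_mx B.
Proof.
apply/matrixP=> i j; rewrite !(mxE, ffunE) /=.
rewrite (reindex (@enum_val (multi_index I) predT)) /=; last first.
  exact/onW_bij/enum_val_bij.
by apply: eq_bigr => k _; rewrite !mxE.
Qed.

Lemma sqtensor_mx_conj_tr A :
  sqtensor_mx (conj_tr A) = (map_mx Num.conj (sqtensor_mx A))^T.
Proof. by apply/matrixP=> i j; rewrite !(mxE, ffunE). Qed.

End Tensors.

Section MatrixMoorePenrose.
Variable C : numClosedFieldType.
Local Notation "M ^h" := (map_mx Num.conj M)^T (at level 2, format "M ^h").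

Let hM m p q (A : 'M[C]_(m, p)) (B : 'M[C]_(p, q)) : (A *m B)^h = B^h *m A^h.
Proof. by rewrite map_mxM trmx_mul. Qed.

Let hK m p (A : 'M[C]_(m, p)) : (A^h)^h = A.
Proof. by apply/matrixP=> i j; rewrite !mxE conjCK. Qed.

Let mulmxh_eq0 m p (A : 'M[C]_(m, p)) : A *m A^h = 0 -> A = 0.
Proof.
move=> /matrixP A0; apply/matrixP=> i j; have := A0 i i.
rewrite !mxE => /eqP; rewrite psumr_eq0 => [|k _]; last first.
  by rewrite !mxE mul_conjC_ge0.
by move=> /allP/(_ j (mem_index_enum _)); rewrite !mxE mul_conjC_eq0 => /eqP.
Qed.

Let gram_unit r p (A : 'M[C]_(r, p)) : row_free A -> A *m A^h \in unitmx.
Proof.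
move=> freeA; rewrite -row_free_unit; apply/row_freeP.
have kerA0 : kermx (A *m A^h) = 0.
  apply: (row_free_inj freeA); rewrite mul0mx; apply: mulmxh_eq0.
  by rewrite hM mulmxA -[_ *m A *m _]mulmxA mulmx_ker mul0mx.
by apply/row_freeP; rewrite -kermx_eq0 kerA0.
Qed.

Let hinv r (A : 'M[C]_r) : A^h = A -> (invmx A)^h = invmx A.
Proof. by move=> hA; rewrite map_invmx trmx_inv hA. Qed.

Lemma mx_mpinv_exists n (A : 'M[C]_n) : exists B : 'M[C]_n,
  [/\ A *m B *m A = A, B *m A *m B = B, (A *m B)^h = A *m B
    & (B *m A)^h = B *m A].
Proof.
have [r [F [G [freeF freeG defA]]]] : exists r,
    exists F : 'M[C]_(n, r), exists G : 'M[C]_(r, n),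
    [/\ row_free F^h, row_free G & A = F *m G].
  exists (\rank A), (col_base A), (row_base A); split; rewrite ?mulmx_base //.
    rewrite /row_free mxrank_tr mxrank_map; exact: col_base_full.
  exact: row_base_free.
have := gram_unit freeF; rewrite hK; set P := F^h *m F => uP.
have := gram_unit freeG; set Q := G *m G^h => uQ.
have hP : P^h = P by rewrite /P hM hK.
have hQ : Q^h = Q by rewrite /Q hM hK.
exists (G^h *m invmx Q *m invmx P *m F^h).
have AB : A *m (G^h *m invmx Q *m invmx P *m F^h) = F *m invmx P *m F^h.
  by rewrite defA !mulmxA -(mulmxA F G) -/Q mulmxK.
have BA : G^h *m invmx Q *m invmx P *m F^h *m A = G^h *m invmx Q *m G.
  by rewrite defA !mulmxA -(mulmxA _ F^h F) -/P mulmxKV.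
rewrite AB BA; split.
- by rewrite defA !mulmxA -(mulmxA _ F^h F) -/P mulmxKV.
- by rewrite !mulmxA -(mulmxA _ G G^h) -/Q mulmxKV.
- by rewrite !hM hK hinv // mulmxA.
- by rewrite !hM hK hinv // mulmxA.
Qed.

End MatrixMoorePenrose.

Section MoorePenrose.
Variables (C : numClosedFieldType) (N : nat) (I : 'I_N -> nat).
Implicit Types A B : sqtensor C I.

Lemma is_mpinv_exists A : exists B, is_mpinv A B.
Proof.
have [M [H1 H2 H3 H4]] := mx_mpinv_exists (sqtensor_mx A).
exists (mx_sqtensor M); split; apply: (can_inj (@sqtensor_mxK C N I));
  by rewrite ?sqtensor_mx_conj_tr !sqtensor_mxM mx_sqtensorK.
Qed.

Lemma is_mpinv_unique A B1 B2 : is_mpinv A B1 -> is_mpinv A B2 -> B1 = B2.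
Proof.
have eM := @sqtensor_mxM C N I.
case=> /(congr1 (@sqtensor_mx _ _ _)) + /(congr1 (@sqtensor_mx _ _ _))
  + /(congr1 (@sqtensor_mx _ _ _)) + /(congr1 (@sqtensor_mx _ _ _)).
rewrite !sqtensor_mx_conj_tr !eM => p1 p2 p3 p4.
case=> /(congr1 (@sqtensor_mx _ _ _)) + /(congr1 (@sqtensor_mx _ _ _))
  + /(congr1 (@sqtensor_mx _ _ _)) + /(congr1 (@sqtensor_mx _ _ _)).
rewrite !sqtensor_mx_conj_tr !eM => q1 q2 q3 q4.
apply: (can_inj (@sqtensor_mxK C N I)).
move: (sqtensor_mx A) (sqtensor_mx B1) (sqtensor_mx B2) p1 p2 p3 p4 q1 q2 q3 q4.
move=> a x y p1 p2 p3 p4 q1 q2 q3 q4.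
have axy : a *m x = a *m y.
  rewrite -p3 -{1}q1 -(mulmxA (a *m y)) map_mxM trmx_mul p3 q3.
  by rewrite mulmxA p1.
have xya : x *m a = y *m a.
  rewrite -p4 -{1}q1 -mulmxA (mulmxA x) map_mxM trmx_mul p4 q4.
  by rewrite -(mulmxA y) (mulmxA a x) p1.
by rewrite -p2 xya -mulmxA axy mulmxA q2.
Qed.

Definition mpinv A : sqtensor C I := sval (cid (is_mpinv_exists A)).

Lemma mpinvP A : is_mpinv A (mpinv A).
Proof. exact: svalP (cid (is_mpinv_exists A)). Qed.

End MoorePenrose.

(* Main.v *)
Require Import Defs.
From mathcomp Require Import all_boot all_order all_algebra reals.

Import GRing.Theory Num.Theory.
Local Open Scope ring_scope.

(** If [A] is invertible, then its Moore-Penrose inverse [B] is the inverse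
  of [A], and [Y = A X] turns [<A X, X> = 0] into [<B Y, Y> = <X, A X> = 0].
  Otherwise [B = B A B] is singular too, and a unit vector of its kernel
  shows that [0 \in W(B)].  The converse follows because [B] and [A] are
  Moore-Penrose inverses of each other. *)

Section NumericalRangeZero.
Context {C : numClosedFieldType} {N : nat} {I : 'I_N -> nat}.
Implicit Types (A B : sqtensor C I) (X Y : tensor C I).

(** Flattens along the same enumeration of multi-indices as [sqtensor_mx], so that [einstein_app]
    becomes a matrix-vector product. *)
Definition tensor_cv X : 'cV[C]_#|multi_index I| := \col_i X (enum_val i).

Lemma tensor_cv_inj : injective tensor_cv.
Proof.
move=> X Y /colP XY; apply/ffunP=> i.
by have := XY (enum_rank i); rewrite !mxE enum_rankK.
Qed.

Lemma tensor_cv_app A X :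
  tensor_cv (einstein_app A X) = sqtensor_mx A *m tensor_cv X.
Proof.
apply/colP=> i; rewrite !(mxE, ffunE).
rewrite (reindex (@enum_val (multi_index I) predT)) /=; last first.
  exact/onW_bij/enum_val_bij.
by apply: eq_bigr => k _; rewrite !mxE.
Qed.

Lemma inner_conj X Y : (inner X Y)^* = inner Y X.
Proof.
rewrite rmorph_sum; apply: eq_bigr => i _.
by rewrite rmorphM /= conjCK mulrC.
Qed.

Lemma inner_ge0 X : 0 <= inner X X.
Proof. by apply: sumr_ge0 => i _; exact: mul_conjC_ge0. Qed.

Lemma inner_eq0 X : (inner X X == 0) = (X == [ffun=> 0]).
Proof.
apply/idP/eqP => [|->]; last first.
  by rewrite /inner big1 // => i _; rewrite ffunE mul0r.
rewrite psumr_eq0 => [/allP X0|i _]; last exact: mul_conjC_ge0.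
apply/ffunP=> i; rewrite ffunE; apply/eqP; rewrite -mul_conjC_eq0.
exact: X0 (mem_index_enum i).
Qed.

Lemma inner_scale c X Y :
  inner [ffun i => c * X i] [ffun i => c * Y i] = c * c^* * inner X Y.
Proof.
rewrite /inner mulr_sumr; apply: eq_bigr => i _.
by rewrite !ffunE rmorphM /= mulrACA.
Qed.

Lemma einstein_app_scale A c X :
  einstein_app A [ffun i => c * X i] = [ffun i => c * einstein_app A X i].
Proof.
apply/ffunP=> i; rewrite !ffunE mulr_sumr; apply: eq_bigr => k _.
by rewrite ffunE mulrCA.
Qed.

(** Scaling [X] by [c] multiplies the form by [c * c^*], so its vanishing does not depend on the
    norm of [X]. *)
Lemma numrange0P A :
  numrange A 0 <->
  exists2 X, X != [ffun=> 0] & inner (einstein_app A X) X = 0.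
Proof.
split=> [[X /= X1 AX0]|[X X0 AX0]].
  exists X => //; rewrite -inner_eq0; apply/eqP => X0.
  by move: X1; rewrite /tnorm X0 sqrtC0 => /esym/eqP; rewrite oner_eq0.
exists [ffun i => (tnorm X)^-1 * X i] => /=; last first.
  by rewrite einstein_app_scale inner_scale AX0 mulr0.
(* Writing 1 as [sqrtC 1] reduces the claim to the squared norm being 1. *)
have -> : tnorm [ffun i => (tnorm X)^-1 * X i] = sqrtC 1; last exact: sqrtC1.
congr sqrtC; rewrite inner_scale -normCK ger0_norm; last first.
  by rewrite invr_ge0 sqrtC_ge0 inner_ge0.
by rewrite exprVn sqrtCK mulVf ?inner_eq0.
Qed.

Lemma singular_numrange0 A :
  sqtensor_mx A \notin unitmx -> numrange A 0.
Proof.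
(* [kermx] is a left kernel, so a null row of the transpose is taken and transposed back. *)
rewrite -unitmx_tr -row_free_unit -kermx_eq0 => /rowV0Pn[v].
move=> /sub_kermxP/(congr1 trmx); rewrite trmx_mul trmxK trmx0 => Av0 v0.
have [X defv] : exists X, tensor_cv X = v^T.
  exists [ffun i => v 0 (enum_rank i)].
  by apply/colP=> i; rewrite !mxE ffunE enum_valK.
have cv0 : tensor_cv [ffun=> 0] = 0 by apply/colP=> i; rewrite !mxE ffunE.
apply/numrange0P; exists X.
  apply: contraNneq v0 => X0.
  by rewrite -(trmxK v) -defv X0 cv0 trmx0.
have -> : einstein_app A X = [ffun=> 0].
  by apply: tensor_cv_inj; rewrite tensor_cv_app defv Av0 cv0.
by apply: big1 => i _; rewrite ffunE mul0r.
Qed.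

Lemma numrange0_mpinv A B : is_mpinv A B -> numrange A 0 -> numrange B 0.
Proof.
case=> _ BAB _ _ /numrange0P[X X0 AX0].
have [uB|] := boolP (sqtensor_mx B \in unitmx); last exact: singular_numrange0.
(* Cancel the invertible [B] on the right of [B A B = B]. *)
have BA1 : sqtensor_mx B *m sqtensor_mx A = 1%:M.
  apply: (can_inj (mulmxK uB)).
  by rewrite mul1mx -!sqtensor_mxM BAB.
have BAX : einstein_app B (einstein_app A X) = X.
  by apply: tensor_cv_inj; rewrite !tensor_cv_app mulmxA BA1 mul1mx.
apply/numrange0P; exists (einstein_app A X).
  (* [A X] is nonzero because [B] maps it back to [X]. *)
  apply: contraNneq X0 => Y0; rewrite -BAX Y0; apply/eqP/ffunP=> i.
  by rewrite !ffunE big1 // => k _; rewrite ffunE mulr0.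
by rewrite BAX -inner_conj AX0 conjC0.
Qed.

End NumericalRangeZero.

Theorem theorem5p4 (R : realType) (N : nat) (I : 'I_N -> nat)
    (A : sqtensor R[i] I) :
  numrange A 0 <-> numrange (mpinv A) 0.
Proof.
have AB := mpinvP A; split; apply: numrange0_mpinv => //.
(* Exchanging [A] and its inverse permutes the four Penrose equations. *)
by case: AB => p1 p2 p3 p4; split.
Qed.
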